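(* Let $F$ be a field of characteristic $p>0$, let $r$ be a power of $p$, $b\in F^\times$, $a\in F\setminus\{0,b^r\}$, $a^*=b^r-a$, $m$ an integer with $1<m<r-1$ and $p\nmid m$, $m^*=r-m$, and \begin{align*} f = M(a,b,m) &= x^{mm^*}(x-b)^{mm^*}\bigl(x^m+a^*b^{-r}((x-b)^m-x^m)\bigr)^m\bigl(x^{m^*}+ab^{-r}((x-b)^{m^*}-x^{m^*})\bigr)^{m^*},\\ g &= x^m(x-a)^{m^*},\\ h &= x^r+a^*b^{-r}(x^{m^*}(x-b)^m-x^r),\\ g^* &= x^{m^*}(x-a^* )^m,\\ h^* &= x^r+ab^{-r}(x^m(x-b)^{m^*}-x^r). \end{align*} Then $f=g\circ h=g^*\circ h^*\in P_{r^2}(F)$ has a $2$-collision (namely $\{(g,h),(g^*,h^* )\}$).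
   Context: $P_n(F)$ is the set of monic original polynomials (leading coefficient $1$, constant coefficient $0$) of degree $n$ in $F[x]$. A $k$-collision of $f\in P_n(F)$ is a set of $k$ distinct pairs $(g,h)$ of monic original polynomials in $F[x]$ of degree at least $2$, all with $g\circ h=g(h)=f$ and all with the same $\deg g$. *)

(* Defs.v *)
From HB Require Import structures.
From mathcomp Require Import all_boot all_order all_algebra.
From mathcomp Require Import finmap.

Set Implicit Arguments.
Unset Strict Implicit.
Unset Printing Implicit Defensive.

Import GRing.Theory.
Local Open Scope ring_scope.

Definition monic_original (F : fieldType) (f : {poly F}) : Prop :=
  f \is monic /\ f`_0 = 0.

Definition monic_original_deg (F : fieldType) (n : nat) (f : {poly F}) : Prop :=
  monic_original f /\ size f = n.+1.

(* Degrees are read off as [size p = deg p + 1], so [2 < size p] is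
   deg p >= 2. *)
Definition is_collision (F : fieldType) (k : nat) (f : {poly F})
    (S : {fset {poly F} * {poly F}}) : Prop :=
  [/\ #|` S|%fset = k,
      forall g h, (g, h) \in S ->
        [/\ monic_original g, monic_original h,
            (2 < size g)%N, (2 < size h)%N & g \Po h = f]
    & forall u v, u \in S -> v \in S -> size u.1 = size v.1].

Definition collM (F : fieldType) (r : nat) (a b : F) (m : nat) : {poly F} :=
  let ms := (r - m)%N in
  let a_s := b ^+ r - a in
  'X ^+ (m * ms) * ('X - b%:P) ^+ (m * ms)
  * ('X^m + (a_s * b ^- r) *: (('X - b%:P) ^+ m - 'X^m)) ^+ m
  * ('X^ms + (a * b ^- r) *: (('X - b%:P) ^+ ms - 'X^ms)) ^+ ms.

(* Main.v *)
Require Import Defs.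
From HB Require Import structures.
From mathcomp Require Import all_boot all_order all_algebra.
From mathcomp Require Import finmap.
From mathcomp Require Import ring.

(** Write m' = r - m, a' = b^r - a, c = a' / b^r and e = a / b^r, so that
c + e = 1.  Then h = x^m' (e x^m + c (x - b)^m), and since (x - b)^r = x^r - b^r
also h - a = (x - b)^m (c x^m' + e (x - b)^m').  Substituting both in
g(h) = h^m (h - a)^m' gives f.  Exchanging (a, m) with (a', m') leaves f
unchanged and yields the other decomposition.  The two decompositions differ
because 0 is a root of the left components with multiplicities m and m', and
m = m' would make m a divisor of a power of p, hence m = 1. *)

Set Implicit Arguments.
Unset Strict Implicit.
Unset Printing Implicit Defensive.

Import GRing.Theory.
Local Open Scope ring_scope.

Section Collision.
Variable F : fieldType.
Implicit Types (a b c : F) (m n r : nat) (u v g h : {poly F}).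

Definition outer a m n : {poly F} := 'X^m * ('X - a%:P) ^+ n.

(** Kept in the shape u + c (v - u), with u and v monic of degree m + n, so that
    [monic_size_combination] applies for every c. *)
Definition inner b c m n : {poly F} :=
  'X^(m + n) + c *: ('X^n * ('X - b%:P) ^+ m - 'X^(m + n)).

(** The leading terms cancel in v - u, so adding c (v - u) only affects coefficients of u below the
    leading one. *)
Lemma monic_size_combination c u v : u \is monic -> v \is monic ->
  size u = size v ->
  u + c *: (v - u) \is monic /\ size (u + c *: (v - u)) = size u.
Proof.
move=> u_mon v_mon suv.
have u_gt0 : (0 < size u)%N by rewrite size_poly_gt0 monic_neq0.
have lt_s : (size (c *: (v - u)) < size u)%N.
  apply: leq_ltn_trans (size_scale_leq _ _) _.
  rewrite -(prednK u_gt0) ltnS; apply/leq_sizeP => j le_j.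
  rewrite coefB; have [->|ne_j] := eqVneq j (size u).-1.
    by rewrite {1}suv -!lead_coefE (monicP u_mon) (monicP v_mon) subrr.
  have lt_j : (size u <= j)%N by rewrite -(prednK u_gt0) ltn_neqAle eq_sym ne_j.
  by rewrite !nth_default ?subrr // -suv.
by rewrite monicE lead_coefDl // -monicE u_mon size_polyDl.
Qed.

Lemma outer_monic a m n : outer a m n \is monic.
Proof. by rewrite monicMl ?monicXn // monic_exp // monicXsubC. Qed.

Lemma size_outer a m n : size (outer a m n) = (m + n).+1.
Proof.
rewrite /outer size_monicM ?monicXn ?monic_neq0 ?monic_exp ?monicXsubC //.
by rewrite size_polyXn size_exp_XsubC addSn addnS.
Qed.

Lemma outer_original a m n : (0 < m)%N -> monic_original (outer a m n).
Proof.
move=> m_gt0; split; first exact: outer_monic.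
by rewrite -horner_coef0 !hornerE expr0n gtn_eqF // mul0r.
Qed.

Lemma inner_monic_size b c m n :
  inner b c m n \is monic /\ size (inner b c m n) = (m + n).+1.
Proof.
rewrite -(size_polyXn F); apply: monic_size_combination; rewrite ?monicXn //.
  exact: outer_monic.
by rewrite -/(outer b n m) size_outer size_polyXn addnC.
Qed.

Lemma inner_original b c m n : (0 < n)%N -> monic_original (inner b c m n).
Proof.
move=> n_gt0; split; first by have [] := inner_monic_size b c m n.
rewrite -horner_coef0 !hornerE !expr0n addn_eq0 !(gtn_eqF n_gt0) andbF.
by rewrite mul0r subr0 mulr0 addr0.
Qed.

Lemma comp_monic_original g h :
  (1 < size h)%N -> monic_original g -> monic_original h ->
  monic_original_deg ((size g).-1 * (size h).-1) (g \Po h).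
Proof.
move=> h_gt1 [g_mon g0] [h_mon h0]; do ![split].
- by rewrite monicE lead_coef_comp // (monicP g_mon) (monicP h_mon) expr1n mulr1.
- by rewrite -horner_coef0 horner_comp horner_coef0 h0 horner_coef0.
- by rewrite -size_comp_poly prednK // size_poly_gt0 monic_neq0 // monicE
    lead_coef_comp // (monicP g_mon) (monicP h_mon) expr1n mulr1.
Qed.

(** By symmetry let m1 < m2. After cancelling x^m1, the value at 0 is (-a1)^n1 on the left, which is
    nonzero, and 0 on the right. *)
Lemma outer_neq a1 a2 m1 m2 n1 n2 : a1 != 0 -> a2 != 0 -> m1 != m2 ->
  outer a1 m1 n1 != outer a2 m2 n2.
Proof.
wlog lt_m : a1 a2 m1 m2 n1 n2 / (m1 < m2)%N.
  move=> W a1N a2N mN; case: (ltngtP m1 m2) (mN) => // lt_m _.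
    exact: W.
  by rewrite eq_sym; apply: W; rewrite // eq_sym.
move=> a1N a2N _; rewrite /outer -(subnKC (ltnW lt_m)) exprD -mulrA.
rewrite (inj_eq (mulfI (monic_neq0 (monicXn F m1)))).
apply/eqP => /(congr1 (horner^~ 0)) /eqP; rewrite !hornerE expr0n subn_eq0.
by rewrite leqNgt lt_m mul0r expf_eq0 oppr_eq0 (negPf a1N) andbF.
Qed.

Lemma outer_comp_inner p a b m n : p \in [pchar F] -> p.-nat (m + n)%N ->
  b != 0 ->
  outer a m n \Po inner b ((b ^+ (m + n) - a) * b ^- (m + n)) m n
    = collM (m + n) a b m.
Proof.
move=> pF p_r bN; set r := (m + n)%N; set c := (_ - _) * _.
have cE : c = 1 - a * b ^- r by rewrite /c mulrBl divff // expf_neq0.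
have hE : inner b c m n = 'X^n * ('X^m + c *: (('X - b%:P) ^+ m - 'X^m)).
  by rewrite /inner exprD -!mul_polyC; ring.
(* F[x] has the characteristic of F, so raising to the power r is additive on polynomials. It also
   commutes with negation, even when p = 2. *)
have poly_r : [pchar {poly F}].-nat r.
  by rewrite (eq_pnat _ (pchar_poly F)) (eq_pnat _ (pcharf_eq pF)).
have frob : ('X - b%:P) ^+ r = 'X^r - (b ^+ r)%:P :> {poly F}.
  by rewrite exprDn_pchar // exprNn_pchar // rmorphXn.
have haE : inner b c m n - a%:P
    = ('X - b%:P) ^+ m * ('X^n + (a * b ^- r) *: (('X - b%:P) ^+ n - 'X^n)).
  (* Writing a as (a / b^r) (x^r - (x - b)^r) cancels the multiples of x^r in h - a, and each
     remaining term contains (x - b)^m. *)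
  have aE : a%:P = (a * b ^- r)%:P * (b ^+ r)%:P.
    by rewrite -polyCM mulfVK // expf_neq0.
  rewrite aE; have -> : (b ^+ r)%:P = 'X^r - ('X - b%:P) ^+ r :> {poly F}.
    by rewrite frob opprB addrC subrK.
  rewrite /inner cE -!mul_polyC polyCB /r !exprD; ring.
rewrite /outer comp_polyM !rmorphXn /= comp_polyB comp_polyX comp_polyC haE hE.
rewrite /collM -/r -/c /r addKn !exprMn -!exprM [(n * m)%N]mulnC.
ring.
Qed.

(** The exchange only swaps the last two factors of [collM], because b^r - (b^r - a) = a and the
    exponent m n is symmetric. *)
Lemma collMC a b m n :
  collM (m + n) (b ^+ (m + n) - a) b n = collM (m + n) a b m.
Proof.
by rewrite /collM addKn addnK subKr [(n * m)%N]mulnC mulrAC.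
Qed.

End Collision.

(** If p^d = 2m, then m divides p^d and equals some p^e: e = 0 contradicts 1 < m, and e > 0
    contradicts that p does not divide m. *)
Lemma pfactor_neq_double p d m : prime p -> (1 < m)%N -> ~~ (p %| m)%N ->
  (p ^ d)%N != (m + m)%N.
Proof.
move=> p_pr m_gt1 pm; apply/eqP => rE.
have /(dvdn_pfactor _ _ p_pr)[[|e] _ mE] : (m %| p ^ d)%N.
- by rewrite rE dvdn_addr.
- by rewrite mE in m_gt1.
- by rewrite mE expnS dvdn_mulr in pm.
Qed.

Theorem theorem3p5 (F : fieldType) (p d r m : nat) (a b : F)
    (hp : p \in [pchar F]) (hr : r = (p ^ d)%N)
    (hb : b != 0) (ha0 : a != 0) (hab : a != b ^+ r)
    (hm : (1 < m < r - 1)%N) (hpm : ~~ (p %| m)%N) :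
  let ms := (r - m)%N in
  let a_s := b ^+ r - a in
  let f := collM r a b m in
  let g := 'X^m * ('X - a%:P) ^+ ms in
  let h := 'X^r + (a_s * b ^- r) *: ('X^ms * ('X - b%:P) ^+ m - 'X^r) in
  let gs := 'X^ms * ('X - a_s%:P) ^+ m in
  let hs := 'X^r + (a * b ^- r) *: ('X^m * ('X - b%:P) ^+ ms - 'X^r) in
  [/\ monic_original_deg (r ^ 2)%N f, f = g \Po h, f = gs \Po hs
    & is_collision 2 f [fset (g, h); (gs, hs)]%fset].
Proof.
move=> ms a_s f g h gs hs.
have p_pr := pcharf_prime hp.
have [m_gt1 m_lt] := andP hm.
have rE : r = (m + ms)%N by rewrite subnKC // ltnW // (leq_trans m_lt) ?leq_subr.
have ms_gt1 : (1 < ms)%N by rewrite ltn_subRL addnC -ltn_subRL.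
have [m_gt0 ms_gt0] := (ltnW m_gt1, ltnW ms_gt1).
have p_r : p.-nat (m + ms)%N by rewrite -rE hr pnatX pnat_id.
have asN : a_s != 0 by rewrite subr_eq0 eq_sym.
have hE : h = inner b (a_s * b ^- r) m ms by rewrite /h {1 3}rE.
have hsE : hs = inner b (a * b ^- r) ms m.
  by rewrite /hs /inner [(ms + m)%N]addnC -rE.
have fE : g \Po h = f.
  by rewrite hE /a_s /f rE (outer_comp_inner a hp).
have fsE : gs \Po hs = f.
  (* For the parameters [a_s] and [ms] the inner constant is (b^r - a_s) / b^r = a / b^r, the one in
     [hs]. *)
  have := @outer_comp_inner F p a_s b ms m hp.
  rewrite [(ms + m)%N]addnC => /(_ p_r hb).
  by rewrite -rE subKr hsE => ->; rewrite /f /a_s {1 2}rE collMC -rE.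
have [_ hS] := inner_monic_size b (a_s * b ^- r) m ms.
have [_ hsS] := inner_monic_size b (a * b ^- r) ms m.
have gS : size g = r.+1 by rewrite rE size_outer.
have gsS : size gs = r.+1 by rewrite rE addnC size_outer.
rewrite -hE -rE in hS; rewrite -hsE addnC -rE in hsS.
have gO : monic_original g by apply: outer_original.
have gsO : monic_original gs by apply: outer_original.
have hO : monic_original h by rewrite hE; apply: inner_original.
have hsO : monic_original hs by rewrite hsE; apply: inner_original.
have r_gt1 : (1 < r)%N by rewrite rE (leq_trans m_gt1) ?leq_addr.
split=> //.
- rewrite -fE; have := comp_monic_original _ gO hO.
  by rewrite gS hS; apply; rewrite ltnS ltnW.
split.
(* The pairs already differ in their left components once m and [ms] differ; equality would give r =
   2m. *)
- rewrite cardfs2 xpair_eqE (negPf (outer_neq _ _ _ _ _)) //.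
  apply/eqP=> mE; have := pfactor_neq_double d p_pr m_gt1 hpm.
  by rewrite -hr rE -mE eqxx.
- move=> u v; rewrite !inE !xpair_eqE.
  by case/orP=> /andP[/eqP-> /eqP->]; rewrite ?gS ?hS ?gsS ?hsS !ltnS; split.
- by move=> u v; rewrite !inE => /orP[]/eqP-> /orP[]/eqP->; rewrite /= ?gS ?gsS.
Qed.
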